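(* Let $M$ be a continuous-time Markov chain with i.i.d. exponential waiting times $\{W_k,\ k\in\mathbb{N}_+\}$ of parameter $\lambda>0$. Let $\alpha\in(0,1)$ and let $\sigma=\{\sigma(t),\ t\in\mathbb{R}_+\}$ be a right-continuous, almost surely strictly increasing $\alpha$-stable process (with zero location parameter), independent of $M$, with no deterministic points of discontinuity and with $\sigma(0)=0$ almost surely. Let $\psi$ be the inverse of $\sigma$, let $Y(t):=M(\psi(t))$, $t\in\mathbb{R}_+$, and let $\boldsymbol{J}_n:=(J_1,\dots,J_n)$ be the vector of the first $n$ waiting times of $Y$. Then, for each $n\in\mathbb{N}_+$ and $\boldsymbol{\xi}\in\mathbb{R}^n$, $$\mathbb{E}e^{i\langle\boldsymbol{\xi},\boldsymbol{J}_n\rangle}=\lambda^n\int_{\mathbb{R}_+^n}\exp\Big\{-\int_{\Omega}\big(-i\langle A_n^T\boldsymbol{\xi},\boldsymbol{s}\rangle\big)^{\alpha}\,\Gamma_{B_n\boldsymbol{w}_n}(d\boldsymbol{s})-\lambda\sum_{j=1}^nw_j\Big\}\,dw_1\cdots dw_n,$$ where $\boldsymbol{w}_n:=(w_1,\dots,w_n)^T$.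
   Context: $\mathbb{N}=\{0,1,2,\dots\}$, $\mathbb{N}_+=\{1,2,\dots\}$, $\mathbb{R}_+=[0,\infty)$. The chain: $M(t)=\tilde M(N(t))$, where $\tilde M=\{\tilde M(n),\ n\in\mathbb{N}\}$ is a discrete-time Markov chain and $N$ is an independent Poisson process of intensity $\lambda$ with inter-arrival times $\{W_k\}$; $\sigma$ is independent of $(\tilde M,N)$. The inverse is $\psi(t):=\inf\{s\in\mathbb{R}_+ : \sigma(s)>t\}$. The waiting times $J_k$ of $Y$ are the successive inter-arrival times of the counting process $N(\psi(t))$, i.e. $Y(t)=\tilde M(n)$ for $\sum_{k=1}^nJ_k\le t<\sum_{k=1}^{n+1}J_k$. Matrices: $I_n$ is the $n\times n$ identity; $(K_n)_{ij}=1$ if $i=j+1$ and $0$ otherwise; $A_n:=I_n-K_n$; $B_n$ is the $n\times n$ lower triangular matrix with all entries on and below the main diagonal equal to $1$. Increasing $\alpha$-stable process: all finite-dimensional distributions are $\alpha$-stable. For $\boldsymbol{t}_n=(t_1,\dots,t_n)$ with $t_1<\dots<t_n$, the vector $\boldsymbol{\sigma}(\boldsymbol{t}_n)=(\sigma(t_1),\dots,\sigma(t_n))^T$ has characteristic function $$\varphi_{\boldsymbol{\sigma}(\boldsymbol{t}_n)}(\boldsymbol{\xi})=\exp\Big\{-\int_\Omega(-i\langle\boldsymbol{\xi},\boldsymbol{s}\rangle)^\alpha\,\Gamma_{\boldsymbol{t}_n}(d\boldsymbol{s})\Big\},\qquad\boldsymbol{\xi}\in\mathbb{R}^n,$$ where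 the spectral measure $\Gamma_{\boldsymbol{t}_n}$ is a finite measure on the unit sphere $\mathcal{S}^{n-1}$ of $\mathbb{R}^n$ carried (because $\sigma$ is positive and increasing) by $\Omega:=\{\boldsymbol{s}\in\mathcal{S}^{n-1}: 0\le s_1\le s_2\le\dots\le s_n\}$. Complex powers are principal. *)

(* Defs.v *)
From HB Require Import structures.
From mathcomp Require Import all_boot all_order all_algebra.
From mathcomp Require Import all_classical all_reals all_analysis.
From mathcomp Require Import complex.

Set Implicit Arguments.
Unset Strict Implicit.
Unset Printing Implicit Defensive.

Import Order.TTheory GRing.Theory Num.Theory.
Import numFieldNormedType.Exports.

Local Open Scope classical_set_scope.
Local Open Scope ring_scope.

Section ComplexFunctions.
Variable R : realType.
Implicit Types z : R[i].

Definition cexp z : R[i] :=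
  Complex (expR (complex.Re z) * cos (complex.Im z))
          (expR (complex.Re z) * sin (complex.Im z)).

Definition cmodulus z : R := Normc.normc z.

(* Principal argument, with values in ]-pi, pi] (and junk at 0). *)
Definition carg z : R :=
  if 0 <= complex.Im z then acos (complex.Re z / cmodulus z)
  else - acos (complex.Re z / cmodulus z).

(* Principal power, real exponent; 0 is sent to 0. *)
Definition cpow z (a : R) : R[i] :=
  if z == 0 then 0 else cexp (Complex (a * ln (cmodulus z)) (a * carg z)).

Definition cintegral d (T : measurableType d) (mu : {measure set T -> \bar R})
    (D : set T) (f : T -> R[i]) : R[i] :=
  Complex (\int[mu]_(x in D) complex.Re (f x))
          (\int[mu]_(x in D) complex.Im (f x)).

End ComplexFunctions.

Section Matrices.
Variable R : realType.

Definition Kmx n : 'M[R]_n := \matrix_(i, j) (i == j.+1 :> nat)%:R.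
Definition Amx n : 'M[R]_n := 1%:M - Kmx n.
Definition Bmx n : 'M[R]_n := \matrix_(i, j) (j <= i)%N%:R.

(* Measure theory on R^n is done on [n.-tuple R], which carries the product
   sigma-algebra; linear algebra is done on columns. *)
Definition col_of n (s : n.-tuple R) : 'cV[R]_n := \col_i tnth s i.

Definition dotp n (u v : 'cV[R]_n) : R := \sum_i u i 0 * v i 0.

End Matrices.

Section LebesgueRn.
Variable R : realType.

Definition cons_pair n (p : n.-tuple R * R) : n.+1.-tuple R :=
  [the n.+1.-tuple R of p.2 :: p.1].

Lemma measurable_cons_pair n : measurable_fun setT (@cons_pair n).
Proof. exact: measurable_cons. Qed.

(* Transported along the isomorphism R^n x R = R^(n+1). *)
Definition lebesgue_step n (m : {measure set (n.-tuple R) -> \bar R}) :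
    {measure set (n.+1.-tuple R) -> \bar R} :=
  measure_function_pushforward__canonical__measure_function_Measure
    (m \x (@lebesgue_measure R))%E (@measurable_cons_pair n).

Fixpoint lebesgue_tuple n : {measure set (n.-tuple R) -> \bar R} :=
  match n with
  | 0%N => @dirac _ _ [tuple] R
  | m.+1 => lebesgue_step (lebesgue_tuple m)
  end.

End LebesgueRn.

Section Independence.
Context d (T : measurableType d) (R : realType) (P : probability T R).

Definition sigma_of d' (E : measurableType d') (I : Type) (D : set I)
    (X : I -> T -> E) : set (set T) :=
  <<s \bigcup_(i in D) preimage_set_system setT (X i) measurable >>.

Definition independent_sigma (F G : set (set T)) : Prop :=
  forall A B, F A -> G B -> P (A `&` B) = (P A * P B)%E.

Definition mutually_independent d' (E : measurableType d') (I : eqType)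
    (X : I -> T -> E) : Prop :=
  forall (s : seq I) (A : I -> set E), uniq s -> (forall i, measurable (A i)) ->
    P (\bigcap_(i in [set` s]) X i @^-1` A i) =
    (\prod_(i <- s) P (X i @^-1` A i))%E.

End Independence.

Section Processes.
Context d (T : measurableType d) (R : realType) (P : probability T R).

Definition markov_chain d' (E : measurableType d') (X : nat -> T -> E) : Prop :=
  exists K : R.-pker E ~> E, forall (n : nat) (A : set T) (B : set E),
    sigma_of [set k | (k <= n)%N] X A -> measurable B ->
    P (A `&` X n.+1 @^-1` B) = (\int[P]_(w in A) K (X n w) B)%E.

(* [W k] is the waiting time W_(k+1): the arrivals are T_k = W_1 + ... + W_k. *)
Definition arrival (W : nat -> T -> R) (k : nat) (w : T) : R :=
  \sum_(i < k) W i w.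

(* Defined also at s = +oo, where the inverse process may take its values; the
   count is +oo when infinitely many arrivals occur before s. *)
Definition counting_process (W : nat -> T -> R) (s : \bar R) (w : T) : \bar R :=
  counting [set k : nat | (0 < k)%N /\ ((arrival W k w)%:E <= s)%E].

(* The infimum of the empty set is +oo: sigma is not assumed unbounded. *)
Definition inverse_process (sigma : R -> T -> R) (t : R) (w : T) : \bar R :=
  ereal_inf [set s%:E | s in [set s : R | 0 <= s /\ t < sigma s w]].

(* Successive times at which a counting process N on R_+ reaches 0, 1, 2, ... *)
Definition epoch (N : R -> T -> \bar R) (k : nat) (w : T) : R :=
  inf [set t : R | 0 <= t /\ (k%:R%:E <= N t w)%E].

(* [inter_arrival N k] is the (k+1)-st inter-arrival time. *)
Definition inter_arrival (N : R -> T -> \bar R) (k : nat) (w : T) : R :=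
  epoch N k.+1 w - epoch N k w.

Definition right_continuous_process (X : R -> T -> R) : Prop :=
  forall (w : T) (t : R), 0 <= t -> X s w @[s --> t^'+] --> X t w.

Definition strictly_increasing_process (X : R -> T -> R) : Prop :=
  {ae P, forall w, forall s t : R, 0 <= s -> s < t -> X s w < X t w}.

(* Almost sure continuity at each fixed time, relatively to R_+. *)
Definition no_fixed_discontinuity (X : R -> T -> R) : Prop :=
  forall t : R, 0 <= t ->
    {ae P, forall w, X s w @[s --> within [set s : R | 0 <= s] (nbhs t)]
                     --> X t w}.

End Processes.

Section Stable.
Context d (T : measurableType d) (R : realType) (P : probability T R).

Definition charfun n (X : T -> 'cV[R]_n) (xi : 'cV[R]_n) : R[i] :=
  cintegral P setT (fun w => cexp (Complex 0 (dotp xi (X w)))).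

Definition tuple_of_col n (v : 'cV[R]_n) : n.-tuple R := [tuple v i 0 | i < n].

(* a X' + b X'' and (a^alpha + b^alpha)^(1/alpha) X + D have the same law, with
   X', X'' independent copies of X, realized on the product space T * T. *)
Definition stable_vector (alpha : R) n (X : T -> 'cV[R]_n) : Prop :=
  forall a b : R, 0 < a -> 0 < b -> exists D : 'cV[R]_n,
  forall A : set (n.-tuple R), measurable A ->
    (P \x P)%E [set w | A (tuple_of_col (a *: X w.1 + b *: X w.2))] =
    P [set w | A (tuple_of_col
                   ((a `^ alpha + b `^ alpha) `^ alpha^-1 *: X w + D))].

Definition increasing_times n (t : 'cV[R]_n) : Prop :=
  (forall i, 0 <= t i 0) /\ (forall i j : 'I_n, (i < j)%N -> t i 0 < t j 0).

Definition at_times (X : R -> T -> R) n (t : 'cV[R]_n) (w : T) : 'cV[R]_n :=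
  \col_i X (t i 0) w.

Definition stable_process (alpha : R) (X : R -> T -> R) : Prop :=
  forall n (t : 'cV[R]_n), (0 < n)%N -> increasing_times t ->
    stable_vector alpha (at_times X t).

Definition Omega n : set (n.-tuple R) :=
  [set s | [/\ \sum_i tnth s i ^+ 2 = 1,
               forall i, 0 <= tnth s i
             & forall i j : 'I_n, (i <= j)%N -> tnth s i <= tnth s j]].

(* The absence of a linear term in the exponent says that the location
   parameter is zero. *)
Definition spectral_measure (alpha : R) n (X : T -> 'cV[R]_n)
    (G : {finite_measure set (n.-tuple R) -> \bar R}) : Prop :=
  G (~` @Omega n) = 0%E /\
  forall xi : 'cV[R]_n,
    charfun X xi =
    cexp (- cintegral G (@Omega n)
              (fun s => cpow (Complex 0 (- dotp xi (col_of s))) alpha)).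

End Stable.

Arguments Omega {R} n.

(* Main.v *)
(* Almost surely sigma is increasing and the arrivals T_k = W_1 + ... + W_k are
   increasing, so the k-th epoch of N(psi(t)) is the left limit sigma(T_k -),
   that is, the limit of sigma(c_m T_k) for c_m = 1 - 1/(m+1).  With the T_k =
   (B_n w)_k read off the first n waiting times w, the vector J_n is thus the
   limit of A_n sigma(c_m B_n w), and <xi, A_n v> = <A_n^T xi, v>.  As sigma is
   independent of w, the expectation is an integral over w of the expectation
   for fixed w, where m can go to infinity since sigma has no fixed
   discontinuity.  What is left is the characteristic function of sigma(B_n w) at A_n^T xi,
   integrated against the product exponential density.  The argument is run
   separately for the cosine and the sine. *)
Require Import Defs.
From HB Require Import structures.
From mathcomp Require Import all_boot all_order all_algebra.
From mathcomp Require Import all_classical all_reals all_analysis.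
From mathcomp Require Import measurable_realfun complex ring.

Set Implicit Arguments.
Unset Strict Implicit.
Unset Printing Implicit Defensive.

Import Order.TTheory GRing.Theory Num.Theory.
Import numFieldNormedType.Exports.

Local Open Scope classical_set_scope.
Local Open Scope ring_scope.

(** * Integrals of functions that agree off a null set *)

Section NullSets.
Context d (T : measurableType d) (R : realType) (mu : {measure set T -> \bar R}).
Import HBNNSimple.

(** The integral of a nonnegative function is by definition a supremum over the simple functions
    below it, whether or not the function is measurable. A simple function below [f], cut to 0 on
    [N], lies below [g]; being measurable, it loses no mass in the cut. *)
Lemma ge0_le_integral_null (N : set T) (f g : T -> \bar R) :
  measurable N -> mu N = 0%E ->
  (forall x, 0 <= f x)%E -> (forall x, 0 <= g x)%E ->
  (forall x, ~ N x -> f x <= g x)%E ->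
  (\int[mu]_x f x <= \int[mu]_x g x)%E.
Proof.
move=> mN N0 f0 g0 fg; rewrite !ge0_integralTE//.
apply: ge_ereal_sup => _ [h /= hf <-].
have mNC : measurable (~` N) by exact: measurableC.
apply: ereal_sup_ubound; exists (proj_nnsfun h mNC) => /=.
  move=> x; have := mrestrict h mNC; move=> /(congr1 (@^~ x)) /= <-.
  rewrite /patch; case: ifPn => // xN.
  by rewrite (le_trans (hf x))// fg//; move: xN; rewrite inE.
have -> : sintegral mu (proj_nnsfun h mNC) = sintegral mu (h \_ (~` N)).
  by rewrite mrestrict.
rewrite -integral_nnsfun// -[in RHS](patch_setT 0 h) -integral_nnsfun//.
rewrite [RHS](@ge0_negligible_integral _ _ _ mu setT N)// ?setTD//.
  exact/measurable_EFinP.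
by move=> x _; rewrite lee_fin.
Qed.

Lemma ge0_eq_integral_null (N : set T) (f g : T -> \bar R) :
  measurable N -> mu N = 0%E ->
  (forall x, 0 <= f x)%E -> (forall x, 0 <= g x)%E ->
  (forall x, ~ N x -> f x = g x)%E ->
  (\int[mu]_x f x = \int[mu]_x g x)%E.
Proof.
move=> mN N0 f0 g0 fg; apply/le_anti/andP.
by split; apply: (ge0_le_integral_null mN) => // x /fg ->.
Qed.

(* Unlike [ae_eq_integral], no measurability is asked of [f] and [g]. *)
Lemma Rintegral_null_eq (N D : set T) (f g : T -> R) :
  measurable N -> mu N = 0%E -> (forall x, D x -> ~ N x -> f x = g x) ->
  \int[mu]_(x in D) f x = \int[mu]_(x in D) g x.
Proof.
move=> mN N0 fg; rewrite /Rintegral; congr fine.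
rewrite integral_mkcond [RHS]integral_mkcond integralE [RHS]integralE.
have pE x : ~ N x -> ((fun x => (f x)%:E) \_ D) x = ((fun x => (g x)%:E) \_ D) x.
  by move=> Nx; rewrite /patch; case: ifPn => //; rewrite inE /= => Dx; rewrite fg.
by congr (_ - _)%E; apply: (ge0_eq_integral_null mN) => // x Nx;
  rewrite ?funeposE ?funenegE pE.
Qed.
End NullSets.

(** * Bounded functions on a probability space *)

Section BoundedOnProbability.
Context d (T : measurableType d) (R : realType) (P : probability T R).

Lemma integrable_bounded (f : T -> R) (c : R) : measurable_fun setT f ->
  (forall x, `|f x| <= c) -> P.-integrable setT (EFin \o f).
Proof.
move=> mf fc; apply: (@le_integrable _ _ _ P setT measurableT _ (cst c%:E)).
- exact/measurable_EFinP.
- by move=> x _ /=; rewrite lee_fin (le_trans (fc x))// ler_norm.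
- exact: finite_measure_integrable_cst.
Qed.

Lemma normr_Rintegral_le (f : T -> R) (c : R) : measurable_fun setT f ->
  (forall x, `|f x| <= c) -> `|\int[P]_x f x| <= c.
Proof.
move=> mf fc; have intf := integrable_bounded mf fc.
apply: (le_trans (le_normr_Rintegral measurableT intf)).
apply: (@le_trans _ _ (\int[P]_(x in setT) c)).
  apply: le_Rintegral => //.
  - apply: (@integrable_bounded (fun x => `|f x|) c) => [|x].
      exact: measurableT_comp.
    by rewrite normr_id.
  - exact: finite_measure_integrable_cst.
by rewrite Rintegral_cst// [X in fine X](probability_setT P) mulr1.
Qed.

(** Cutting all functions to 0 on [N] makes the convergence hold everywhere, so the cut limit is
    measurable and dominated convergence applies with the constant [c]. This serves for limits that
    are functions of [J], whose measurability is not assumed. *)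
Lemma cvg_Rintegral_bounded (N : set T) (f_ : nat -> T -> R) (f : T -> R) (c : R) :
  measurable N -> P N = 0%E -> (forall m, measurable_fun setT (f_ m)) ->
  (forall m x, `|f_ m x| <= c) ->
  (forall x, ~ N x -> f_ m x @[m --> \oo] --> f x) ->
  \int[P]_x f_ m x @[m --> \oo] --> \int[P]_x f x.
Proof.
move=> mN N0 mf fc cf.
pose g_ m := f_ m \_ (~` N); pose g := f \_ (~` N).
have mg m : measurable_fun setT (g_ m).
  apply/(measurable_restrictT _ (measurableC mN)).
  exact: measurable_funTS.
have cg x : g_ m x @[m --> \oo] --> g x.
  rewrite /g_ /g /patch; case: ifPn; first by rewrite inE; exact: cf.
  by move=> _; exact: cvg_cst.
have mg' : measurable_fun setT g.
  by apply: (@measurable_fun_cvg _ _ _ _ g_) => // x _; exact: cg.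
have c0 : 0 <= c by exact: le_trans (normr_ge0 _) (fc 0%N point).
have gc m x : `|g_ m x| <= c by rewrite /g_ /patch; case: ifP => // _; rewrite normr0.
have [|||ig _ cvgI] := @dominated_convergence _ _ _ P setT measurableT
  (fun m => EFin \o g_ m) (EFin \o g) (cst c%:E)
  (fun m => (measurable_EFinP _ _).2 (mg m)) ((measurable_EFinP _ _).2 mg').
- by apply: aeW => x _; apply: cvg_EFin; [exact: nearW|exact: cg].
- exact: finite_measure_integrable_cst.
- by apply: aeW => x m _ /=; rewrite lee_fin.
rewrite (Rintegral_null_eq (g := g) mN N0); last first.
  by move=> x _ Nx; rewrite /g /patch mem_set.
rewrite (_ : (fun m => _) = fun m => \int[P]_x g_ m x); last first.
  apply/funext => m; apply: (Rintegral_null_eq mN N0).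
  by move=> x _ Nx; rewrite /g_ /patch mem_set.
apply: fine_cvg; rewrite fineK; first exact: cvgI.
exact: integrable_fin_num.
Qed.
End BoundedOnProbability.

(** * Powers of a sigma-finite measure, on tuples *)

Section SigmaFiniteMeasure.
Context d (T : measurableType d) (R : realType) (m : {measure set T -> \bar R}).

(** A copy of [m] that carries the proof of sigma-finiteness as a canonical structure. The measures
    on tuples come from a recursion and are sigma-finite only by a lemma, whereas Tonelli asks for
    the structure. *)
Definition sigma_finite_of of sigma_finite setT m : set T -> \bar R := m.

HB.instance Definition _ (sf : sigma_finite setT m) :=
  Measure.copy (sigma_finite_of sf) m.
HB.instance Definition _ (sf : sigma_finite setT m) :=
  Measure_isSigmaFinite.Build _ _ _ (sigma_finite_of sf) sf.

End SigmaFiniteMeasure.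

Section TupleMeasure.
Context (R : realType).

Definition cons_measure (mu : {sigma_finite_measure set (measurableTypeR R) -> \bar R}) n
    (m : {measure set (n.-tuple R) -> \bar R}) :
    {measure set (n.+1.-tuple R) -> \bar R} :=
  measure_function_pushforward__canonical__measure_function_Measure
    (m \x mu)%E (@measurable_cons_pair R n).

(** The recursion of [lebesgue_tuple] with [mu] left free, so that Lebesgue measure and the
    exponential law can be compared by one induction on [n]. *)
Fixpoint tuple_measure (mu : {sigma_finite_measure set (measurableTypeR R) -> \bar R}) n :
    {measure set (n.-tuple R) -> \bar R} :=
  match n with
  | 0%N => @dirac _ _ [tuple] R
  | m.+1 => cons_measure mu (tuple_measure mu m)
  end.

Lemma lebesgue_tupleE n : lebesgue_tuple R n = tuple_measure (@lebesgue_measure R) n.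
Proof. by elim: n => //= n ->. Qed.

Variable mu : {sigma_finite_measure set (measurableTypeR R) -> \bar R}.

Lemma measurable_rectangle n (A : 'I_n -> set R) :
  (forall i, measurable (A i)) ->
  measurable [set t : n.-tuple R | forall i, A i (tnth t i)].
Proof.
move=> mA; rewrite (_ : [set _ | _] = \bigcap_(i in [set: 'I_n])
    ((fun t : n.-tuple R => tnth t i) @^-1` A i)).
  apply: fin_bigcap_measurable => // i _.
  by rewrite -[X in measurable X]setTI; exact: measurable_tnth.
by apply/seteqP; split => t /= H i => [_|]; exact: H.
Qed.

Lemma tuple_measure_rectangle n (A : 'I_n -> set R) :
  (forall i, measurable (A i)) ->
  tuple_measure mu n [set t | forall i, A i (tnth t i)] = (\prod_(i < n) mu (A i))%E.
Proof.
elim: n A => [|n IH] A mA.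
  rewrite big_ord0 /= diracE mem_set//=.
  by case.
rewrite big_ord_recl /= /pushforward /=.
pose B := [set t : n.-tuple R | forall i : 'I_n, A (lift ord0 i) (tnth t i)].
rewrite (_ : _ @^-1` _ = B `*` A ord0); last first.
  apply/seteqP; split => -[t x] /= H.
    split => [i|]; first by have := H (lift ord0 i); rewrite tnthS.
    exact: H ord0.
  move=> i; case: (unliftP ord0 i) => [j ->|->]; last exact: H.2.
  by rewrite tnthS; exact: H.1.
have mB : measurable B.
  exact: (@measurable_rectangle n (fun i => A (lift ord0 i)) (fun i => mA (lift ord0 i))).
rewrite product_measure1E//; last exact: mA.
have := IH (fun i => A (lift ord0 i)) (fun i => mA (lift ord0 i)); rewrite -/B => ->.
by rewrite muleC.
Qed.

(** Products of exhausting sets for the two factors are pulled back along [u], the measurable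
    inverse of [cons_pair]; their masses are those of the products. *)
Lemma tuple_measure_sigma_finite n : sigma_finite setT (tuple_measure mu n).
Proof.
elim: n => [|n IH] /=; first by exact: sigma_finiteT.
have /sigma_finiteP[F [TF ndF Foo]] := IH.
have /sigma_finiteP[G [TG ndG Goo]] := sigma_finiteT mu.
pose u (t : n.+1.-tuple R) := ([tuple of behead t], thead t).
have mu_u : measurable_fun setT u.
  apply: measurable_fun_pair; first exact: measurable_behead.
  exact: measurable_tnth.
exists (fun k => u @^-1` (F k `*` G k)).
  rewrite -preimage_bigcup; apply/esym/seteqP; split => // t _.
  have [i _ Fi] : (\bigcup_i F i) (u t).1 by rewrite -TF.
  have [j _ Gj] : (\bigcup_i G i) (u t).2 by rewrite -TG.
  exists (maxn i j) => //; split.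
  - by move: Fi; exact/subsetPset/ndF/leq_maxl.
  - by move: Gj; exact/subsetPset/ndG/leq_maxr.
move=> k; have [mF Fk] := Foo k; have [mG Gk] := Goo k.
have mFG : measurable (F k `*` G k) by exact: measurableX.
split; first by rewrite -[X in measurable X]setTI; exact: mu_u.
rewrite /pushforward (_ : _ @^-1` _ = F k `*` G k).
  by rewrite product_measure1E// lte_mul_pinfty// ge0_fin_numE.
have uK p : u (cons_pair p) = p.
  case: p => t x; congr (_, _); first exact/val_inj.
transitivity ((u \o @cons_pair R n) @^-1` (F k `*` G k)) => //.
by rewrite (_ : u \o _ = id) ?preimage_id//; apply/funext.
Qed.
End TupleMeasure.

(** * Integration against a measure given by a density *)

Section Density.
Local Open Scope ereal_scope.
Context d (T : measurableType d) (R : realType).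
Variables (mu nu : {measure set T -> \bar R}) (p : T -> R).
Hypotheses (mp : measurable_fun setT p) (p0 : forall x, (0 <= p x)%R).
Hypothesis nuE : forall A, measurable A -> nu A = \int[mu]_(x in A) (p x)%:E.
Import HBNNSimple.

Let mpE : measurable_fun setT (EFin \o p).
Proof. exact/measurable_EFinP. Qed.

(** Both sides are sums over the values of [h], and on the level set of one value the claim is
    [nuE]. *)
Let integral_density_nnsfun (h : {nnsfun T >-> R}) :
  \int[nu]_x (h x)%:E = \int[mu]_x ((h x)%:E * (p x)%:E).
Proof.
transitivity (\int[nu]_x
   (\sum_(y \in range h) (y * \1_(h @^-1` [set y]) x)%:E)).
  by apply: eq_integral => t tE; rewrite /= fimfunE -fsumEFin.
have indich r : measurable_fun setT (fun x => (r * \1_(h @^-1` [set r]) x)%:E).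
  by apply: (measurable_comp measurableT) => //; exact: measurable_funM.
rewrite ge0_integral_fsum//; last by move=> m y Ey; exact: nnfun_muleindic_ge0.
transitivity (\int[mu]_x (\sum_(y \in range h)
    (y * \1_(h @^-1` [set y]) x)%:E * (p x)%:E)); last first.
  under [RHS]eq_integral => x xE.
    rewrite fimfunE -fsumEFin// ge0_mule_fsuml => [|y]; last exact: nnfun_muleindic_ge0.
    over.
  by [].
rewrite [RHS]ge0_integral_fsum//; last 2 first.
  - by move=> y; apply: emeasurable_funM.
  - by move=> m y Ey; rewrite mule_ge0 ?lee_fin// -lee_fin nnfun_muleindic_ge0.
apply: eq_fsbigr => r rhn.
under eq_integral do rewrite EFinM.
rewrite integralZl_indic_nnsfun => //.
under [RHS]eq_integral do rewrite EFinM -muleA.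
(* A negative [r] has an empty level set, since [h] is nonnegative: both sides are 0. *)
have [r0|r0] := leP 0%R r; last first.
  rewrite preimage_nnfun0// integral_indic// set0I measure0 mule0.
  by rewrite integral0_eq// => x _; rewrite indic0 mul0e mule0.
rewrite ge0_integralZl//.
- under [in RHS]eq_integral do rewrite muleC.
  rewrite [in RHS](eq_integral ((EFin \o p) \_ (h @^-1` [set r]))); last first.
    by move=> x xE; rewrite epatch_indic.
  by rewrite -integral_mkcond -nuE// integral_indic// setIT.
- by apply: emeasurable_funM => //; exact/measurable_EFinP.
- by move=> x _; rewrite mule_ge0// lee_fin.
Qed.

(** Monotone convergence along simple approximations of [f], once under [nu] and once under [mu];
    the factor [p] is nonnegative and so preserves monotonicity. *)
Lemma ge0_integral_density (f : T -> \bar R) : measurable_fun setT f ->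
  (forall x, 0 <= f x) -> \int[nu]_x f x = \int[mu]_x (f x * (p x)%:E).
Proof.
move=> mf f0; pose h := nnsfun_approx measurableT mf.
have cvgh x : EFin (h n x) @[n --> \oo] --> f x by exact: cvg_nnsfun_approx.
transitivity (lim (\int[nu]_x (EFin \o h n) x @[n --> \oo])).
  under eq_integral => x _ do rewrite -(cvg_lim _ (cvgh x))//.
  apply: monotone_convergence => //.
  - by move=> n; apply/measurable_EFinP.
  - by move=> n x _ //=; rewrite lee_fin.
  - by move=> x _ a b ab; rewrite lee_fin; exact/lefP/nd_nnsfun_approx.
transitivity (lim (\int[mu]_x ((EFin \o h n) x * (p x)%:E) @[n --> \oo])).
  by apply: congr_lim; apply/funext => n /=; exact: integral_density_nnsfun.
apply/esym.
have fg x : f x * (p x)%:E = lim (((EFin \o h n) x * (p x)%:E) @[n --> \oo]).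
  by apply/esym/cvg_lim => //; apply: cvgeZr => //; exact: cvgh.
under eq_integral => x _ do rewrite fg.
apply: monotone_convergence => //.
- by move=> n; apply: emeasurable_funM => //; exact/measurable_EFinP.
- by move=> n x Ex /=; rewrite mule_ge0 ?lee_fin.
- by move=> x Ex a b ab/=; rewrite lee_wpmul2r ?lee_fin//; exact/lefP/nd_nnsfun_approx.
Qed.

End Density.

Section TupleDensity.
Local Open Scope ereal_scope.
Context (R : realType) (mu nu : {sigma_finite_measure set (measurableTypeR R) -> \bar R}).
Variable p : R -> R.
Hypotheses (mp : measurable_fun setT p) (p0 : forall x, (0 <= p x)%R).
Hypothesis nuE : forall A, measurable A -> nu A = \int[mu]_(x in A) (p x)%:E.

Definition tuple_pdf n (t : n.-tuple R) : R := (\prod_(i < n) p (tnth t i))%R.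

Lemma tuple_pdf_ge0 n (t : n.-tuple R) : (0 <= tuple_pdf t)%R.
Proof. by apply: prodr_ge0. Qed.

Lemma measurable_tuple_pdf n : measurable_fun setT (@tuple_pdf n).
Proof.
apply: measurable_prod => i _; apply: measurableT_comp => //.
exact: measurable_tnth.
Qed.

(** Tonelli separates the head from the tail of the tuple. The induction hypothesis changes the
    measure on the tail, the one-dimensional density that on the head, and the density of the tail
    moves into the inner integral as a constant. *)
Lemma ge0_integral_tuple_density n (f : n.-tuple R -> \bar R) :
  measurable_fun setT f -> (forall x, 0 <= f x) ->
  \int[tuple_measure nu n]_t f t = \int[tuple_measure mu n]_t (f t * (tuple_pdf t)%:E).
Proof.
have mtp k : measurable_fun setT (fun t : k.-tuple R => (tuple_pdf t)%:E).
  by apply/measurable_EFinP; exact: measurable_tuple_pdf.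
elim: n f => [|n IH] f mf f0.
  rewrite /= !integral_dirac//=; last first.
    by apply: emeasurable_funM => //; exact: mtp.
  by rewrite /tuple_pdf big_ord0 mule1.
have mfc : measurable_fun setT (f \o @cons_pair R n).
  by apply: measurableT_comp => //; exact: measurable_cons_pair.
pose mun : {sigma_finite_measure set (n.-tuple R) -> \bar R} :=
  sigma_finite_of (tuple_measure_sigma_finite mu n).
pose nun : {sigma_finite_measure set (n.-tuple R) -> \bar R} :=
  sigma_finite_of (tuple_measure_sigma_finite nu n).
rewrite /= ge0_integral_pushforward//=; last by exact: (@measurable_cons_pair R n).
rewrite ge0_integral_pushforward//=; last 3 first.
- exact: (@measurable_cons_pair R n).
- by apply: emeasurable_funM => //; exact: mtp.
- by move=> t _; rewrite mule_ge0// lee_fin tuple_pdf_ge0.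
rewrite preimage_setT.
rewrite [LHS](@fubini_tonelli1 _ _ _ _ _ nun nu _ mfc)//; last by move=> x; exact: f0.
rewrite [LHS]IH//; last 2 first.
- by apply: (@measurable_fun_fubini_tonelli_F _ _ _ _ _ nu _ mfc) => x; exact: f0.
- by move=> t; apply: integral_ge0 => x _; exact: f0.
have mg : measurable_fun setT
    ((fun t => f t * (tuple_pdf t)%:E) \o @cons_pair R n).
  apply: measurableT_comp; last by exact: measurable_cons_pair.
  by apply: emeasurable_funM => //; exact: mtp.
rewrite [RHS](@fubini_tonelli1 _ _ _ _ _ mun mu _ mg)//; last first.
  by move=> t /=; rewrite mule_ge0// lee_fin tuple_pdf_ge0.
apply: eq_integral => t _; rewrite /fubini_F /=.
have mft : measurable_fun setT (fun x => f (cons_pair (t, x))).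
  exact: (measurable_fun_pair2 _ mfc).
rewrite (@ge0_integral_density _ _ _ mu nu p mp p0 nuE _ mft)//.
rewrite -ge0_integralZr//; last 3 first.
- by apply: emeasurable_funM => //; exact/measurable_EFinP.
- by move=> x _; rewrite mule_ge0// lee_fin.
- by rewrite lee_fin tuple_pdf_ge0.
apply: eq_integral => x _; rewrite -muleA; congr (_ * _).
rewrite -EFinM; congr EFin; rewrite /tuple_pdf big_ord_recl; congr (_ * _)%R.
by apply: eq_bigr => i _; rewrite tnthS.
Qed.
(** Multiplication by the nonnegative density commutes with taking positive and negative parts,
    which reduces the claim to the nonnegative case. *)
Lemma Rintegral_tuple_density n (f : n.-tuple R -> R) : measurable_fun setT f ->
  (\int[tuple_measure nu n]_t f t = \int[tuple_measure mu n]_t (f t * tuple_pdf t))%R.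
Proof.
move=> mf; rewrite /Rintegral; congr fine.
have mfE : measurable_fun setT (fun t => (f t)%:E) by exact/measurable_EFinP.
rewrite integralE [RHS]integralE; congr (_ - _).
- rewrite ge0_integral_tuple_density//; last exact: measurable_funepos.
  apply: eq_integral => t _; rewrite !funeposE -!EFin_max -EFinM; congr EFin.
  by rewrite maxr_pMl ?tuple_pdf_ge0// mul0r.
- rewrite ge0_integral_tuple_density//; last exact: measurable_funeneg.
  apply: eq_integral => t _; rewrite !funenegE -!EFinN -!EFin_max -EFinM; congr EFin.
  by rewrite maxr_pMl ?tuple_pdf_ge0// mul0r mulNr.
Qed.

End TupleDensity.

(** * Joint law of the first waiting times *)

Section TupleLaw.
Context d (T : measurableType d) (R : realType) (P : probability T R).
Variable W : nat -> {RV P >-> R}.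
Variable mu : {sigma_finite_measure set (measurableTypeR R) -> \bar R}.
Hypothesis W_indep : mutually_independent P W.
Hypothesis W_law : forall k A, measurable A -> distribution P (W k) A = mu A.

Definition initial_tuple n (w : T) : n.-tuple R := [tuple W i w | i < n].

Lemma measurable_initial_tuple n : measurable_fun setT (@initial_tuple n).
Proof.
apply/measurable_fun_tnthP => i.
rewrite (_ : _ \o _ = W i); first exact: measurable_funP.
by apply/funext => w; rewrite /= tnth_mktuple.
Qed.

(** Rectangles generate the sigma-algebra and are stable under intersection, so two finite measures
    that agree on them are equal; on a rectangle the agreement is mutual independence. *)
Lemma initial_tuple_law n (A : set (n.-tuple R)) : measurable A ->
  P (@initial_tuple n @^-1` A) = tuple_measure mu n A.
Proof.
move=> mA.
pose C := [set C | exists B : 'I_n -> set R, (forall i, measurable (B i)) /\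
  C = [set t : n.-tuple R | forall i, B i (tnth t i)]].
pose law : {measure set (n.-tuple R) -> \bar R} :=
  measure_function_pushforward__canonical__measure_function_Measure P
    (@measurable_initial_tuple n).
apply: (measure_unique C (fun=> setT) _ _ _ _ law) => //.
- apply/seteqP; split; apply: smallest_sub; first exact: smallest_sigma_algebra.
  + move=> X; rewrite -bigcup_seq => -[i /= _ [Y mY <-]].
    apply: sub_sigma_algebra.
    exists (fun j => if j == i then Y else setT); split.
      by move=> j; case: ifP.
    apply/seteqP; split => t /=.
      by move=> [_ Yt] j; case: ifP => // /eqP ->.
    by move=> /(_ i); rewrite eqxx.
  + exact: sigma_algebra_measurable.
  + by move=> _ [B [mB ->]]; exact: measurable_rectangle.
- move=> _ _ [B [mB ->]] [B' [mB' ->]].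
  exists (fun i => B i `&` B' i); split; first by move=> i; exact: measurableI.
  apply/seteqP; split => t /= H.
    by move=> i; split; [exact: H.1|exact: H.2].
  by split => i; have [] := H i.
- by move=> _; exists (fun=> setT); split => //; apply/seteqP; split.
- by rewrite bigcup_const//; exists 0%N.
- move=> _ [B [mB ->]]; rewrite tuple_measure_rectangle// /law /= /pushforward.
  (* Independence takes a family of sets indexed by all of [nat]; the sides of the rectangle are
     extended by [setT]. *)
  pose B' k := if insub k is Some i then B i else setT.
  have := W_indep (iota_uniq 0 n) (A := B') _.
  rewrite (_ : \bigcap_(i in _) _ =
     @initial_tuple n @^-1` [set t | forall i, B i (tnth t i)]); last first.
    apply/seteqP; split => w /= H.
      move=> i; rewrite tnth_mktuple; have := H i.
      by rewrite /B' valK; apply; rewrite /= mem_iota /= ltn_ord.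
    move=> k; rewrite /= mem_iota /= => kn; rewrite /B' insubT /=.
    by have := H (Ordinal kn); rewrite tnth_mktuple.
  move=> ->; last by move=> k; rewrite /B'; case: insub.
  rewrite -[in iota 0 n](subn0 n) -/(index_iota 0 n) big_mkord.
  by apply: eq_bigr => i _; rewrite /B' valK -(W_law i).
- by move=> _; rewrite /law /= /pushforward preimage_setT probability_setT ltry.
Qed.

End TupleLaw.

(** * Fubini for independent random elements *)

Section IndependentFubini.
Context d d1 d2 (T : measurableType d) (T1 : measurableType d1) (T2 : measurableType d2).
Context (R : realType) (P : probability T R).
Variables (X : {mfun T >-> T1}) (Y : {mfun T >-> T2}).
Hypothesis XY_indep : forall A B, measurable A -> measurable B ->
  P (X @^-1` A `&` Y @^-1` B) = (P (X @^-1` A) * P (Y @^-1` B))%E.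

(** By uniqueness of the product measure, independence makes the law of the pair the product of the
    two laws; Fubini applies since a bounded [F] is integrable. *)
Lemma Rintegral_independent (F : T1 * T2 -> R) (c : R) :
  measurable_fun setT F -> (forall p, `|F p| <= c) ->
  \int[P]_w F (X w, Y w) = \int[distribution P Y]_y \int[P]_w F (X w, y).
Proof.
move=> mF Fc.
have mXY : measurable_fun setT (fun w => (X w, Y w)) by exact: measurable_fun_pair.
pose XY : {mfun T >-> (T1 * T2)%type} := HB.pack (fun w => (X w, Y w))
  (isMeasurableFun.Build _ _ _ _ _ mXY).
have mFE : measurable_fun setT (EFin \o F) by exact/measurable_EFinP.
have mFy y : measurable_fun setT (fun x => F (x, y)).
  exact: (measurable_fun_pair1 _ mF).
have dXY A : measurable A ->
    (distribution P X \x distribution P Y)%E A = distribution P XY A.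
  by apply: product_measure_unique => B C mB mC; exact: XY_indep.
have iF y : \int[P]_w F (X w, y) = \int[distribution P X]_x F (x, y).
  rewrite /Rintegral [in RHS]integral_pushforward//; last 2 first.
  - exact/measurable_EFinP.
  - rewrite preimage_setT.
    apply: (@integrable_bounded _ _ _ P (fun w => F (X w, y)) c) => //.
    exact: (measurableT_comp (mFy y) (measurable_funP X)).
under [RHS]eq_Rintegral do rewrite iF.
rewrite /Rintegral; congr fine.
transitivity (\int[distribution P XY]_p (F p)%:E)%E.
  rewrite integral_pushforward//; last first.
    rewrite preimage_setT.
    apply: (@integrable_bounded _ _ _ P (fun w => F (X w, Y w)) c) => //.
    exact: (measurableT_comp mF mXY).
transitivity (\int[(distribution P X \x distribution P Y)%E]_p (F p)%:E)%E.
  by apply: eq_measure_integral => A mA _; exact: (esym (dXY A mA)).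
rewrite -integral21_prod_meas1; last first.
  exact: (@integrable_bounded _ _ _ (distribution P X \x distribution P Y)%E _ c).
apply: eq_integral => y _; rewrite /fubini_G fineK//.
apply: integrable_fin_num => //.
exact: (@integrable_bounded _ _ _ (distribution P X) _ c).
Qed.

Lemma measurable_Rintegral_fst (F : T1 * T2 -> R) (c : R) :
  measurable_fun setT F -> (forall p, `|F p| <= c) ->
  measurable_fun setT (fun y => \int[P]_w F (X w, y)).
Proof.
move=> mF Fc.
have mFy y : measurable_fun setT (fun x => F (x, y)).
  exact: (measurable_fun_pair1 _ mF).
rewrite (_ : (fun y => _) =
    fine \o fubini_G (distribution P X) (fun p => (F p)%:E)); last first.
  apply/funext => y; rewrite /= /fubini_G /Rintegral integral_pushforward//.
  - exact/measurable_EFinP.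
  - rewrite preimage_setT.
    apply: (@integrable_bounded _ _ _ P (fun w => F (X w, y)) c) => //.
    exact: (measurableT_comp (mFy y) (measurable_funP X)).
apply: measurableT_comp => //.
apply: (@measurable_fubini_G _ _ _ _ _ (distribution P X) (distribution P Y)).
exact: (@integrable_bounded _ _ _ (distribution P X \x distribution P Y)%E _ c).
Qed.
End IndependentFubini.

(** * The path of a process as a random element *)

Section PathSpace.
Context d (T : measurableType d) (R : realType) (P : probability T R).
Variable X : R -> {RV P >-> R}.

Definition path_sets : set (set T) :=
  \bigcup_(t in [set t : R | 0 <= t]) preimage_set_system setT (X t) measurable.

(** In place of a space of functions, the path space is [T] with the smaller sigma-algebra generated
    by the process at times [t >= 0], and the identity is the random path. Its measurable sets are
    exactly those of [sigma_of] in the independence hypothesis on [sigma]. *)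
Definition path_space := g_sigma_algebraType path_sets.

Definition to_path_space (w : T) : path_space := w.

Lemma measurable_to_path_space : measurable_fun setT to_path_space.
Proof.
move=> _ A mA; rewrite setTI.
suff : path_sets.-sigma.-measurable `<=` (measurable : set (set T)) by exact.
apply: smallest_sub; first exact: sigma_algebra_measurable.
by move=> _ [t _ [B mB <-]]; exact: measurable_funP.
Qed.

HB.instance Definition _ :=
  isMeasurableFun.Build _ _ _ _ to_path_space measurable_to_path_space.

Lemma measurable_path_at t : 0 <= t ->
  measurable_fun [set: path_space] (X t : path_space -> R).
Proof.
move=> t0 _ A mA; rewrite setTI; apply: sub_sigma_algebra.
by exists t => //; exists A => //; rewrite setTI.
Qed.

Hypothesis X_rc : right_continuous_process X.

(** Time is discretized from the right on a grid of mesh [1 / c m]. The discretized process is a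
    countable patchwork of the [X t] at fixed times, hence jointly measurable, and by right
    continuity it converges pointwise. *)
Lemma measurable_path_joint :
  measurable_fun [set: R * path_space] (fun p => X (Num.max p.1 0) p.2).
Proof.
pose c m : R := m.+1%:R.
have c0 m : 0 < c m by rewrite /c ltr0n.
pose j m (t : R) := Num.truncn (c m * Num.max t 0).
have jP m t : (j m t)%:R <= c m * Num.max t 0 < (j m t).+1%:R.
  apply: truncn_itv; rewrite mulr_ge0 ?(ltW (c0 m))//.
  by rewrite le_max lexx orbT.
(* The successor puts the grid point strictly to the right of the time, as the limit at [t^'+]
   requires. *)
pose h m (p : R * path_space) := X ((j m p.1).+1%:R / c m) p.2.
apply: (@measurable_fun_cvg _ _ _ _ h) => [m|[t w] _].
  move=> _ A mA; rewrite setTI.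
  rewrite (_ : _ @^-1` _ = \bigcup_k
     ([set t | (k%:R <= c m * Num.max t 0 < k.+1%:R)] `*`
     (X (k.+1%:R / c m) @^-1` A))); last first.
    apply/seteqP; split => [[t w] /= H|[t w] /= [k _ [/= tk H]]].
      by exists (j m t) => //; split => //=; exact: jP.
    by rewrite /h /=; rewrite (_ : j m t = k)//; exact: truncn_def.
  apply: bigcup_measurable => k _; apply: measurableX; last first.
    rewrite -[X in measurable X]setTI; apply: measurable_path_at => //.
    by rewrite divr_ge0// ltW.
  have mf : measurable_fun setT (fun t : R => c m * Num.max t 0).
    apply: measurable_funM => //; apply: measurable_maxr => //.
  have := mf measurableT `[k%:R, k.+1%:R[%classic (measurable_itv _).
  by rewrite setTI; congr measurable; apply/seteqP; split => t /=; rewrite in_itv.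
have t0 : 0 <= Num.max t 0 by rewrite le_max lexx orbT.
have /cvg_at_rightP := @X_rc w (Num.max t 0) t0.
apply; split => [m|].
  by rewrite ltr_pdivlMr// mulrC; have /andP[] := jP m t.
apply: (@squeeze_cvgr _ _ _ _ (fun=> Num.max t 0) (fun m => Num.max t 0 + (c m)^-1)).
- apply: nearW => m; have /andP[jle jlt] := jP m t; apply/andP; split.
    by rewrite ler_pdivlMr// mulrC ltW.
  rewrite ler_pdivrMr// mulrDl mulVf ?gt_eqF// mulrC -natr1 lerD2r.
  by rewrite jle.
- exact: cvg_cst.
- rewrite -[X in _ --> X]addr0; apply: cvgD; first exact: cvg_cst.
  exact: cvg_harmonic.
Qed.
End PathSpace.

(** * Epochs of the time-changed counting process *)

Section Epochs.
Context d (T : measurableType d) (R : realType).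
Variables (W : nat -> T -> R) (w : T).
Hypothesis W_gt0 : forall i, 0 < W i w.

Lemma arrivalS k : arrival W k.+1 w = arrival W k w + W k w.
Proof. by rewrite /arrival big_ord_recr. Qed.

Lemma arrival_ge0 k : 0 <= arrival W k w.
Proof. by apply: sumr_ge0 => i _; exact: ltW. Qed.

Lemma arrival_le i j : (i <= j)%N -> arrival W i w <= arrival W j w.
Proof.
apply: (@homo_leq _ (fun k => arrival W k w) <=%R) => [//|y x z|k].
  exact: le_trans.
by rewrite arrivalS lerDl ltW.
Qed.

(** Arrivals are ordered: if the [k]-th is at most [x], the counted set contains 1, ..., [k];
    otherwise it is contained in 1, ..., [k - 1]. *)
Lemma counting_process_ge k (x : \bar R) : (0 < k)%N ->
  (k%:R%:E <= counting_process W x w)%E <-> ((arrival W k w)%:E <= x)%E.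
Proof.
move=> k0; rewrite /counting_process; set A := [set _ | _].
(* The set 1, ..., [n]: the index 0, with its arrival at time 0, is not counted. *)
pose I n : set nat := `I_n.+1 `\` `I_1.
have IE n i : I n i <-> (0 < i <= n)%N.
  rewrite /I /= !ltnS; split => [[-> /negP]|/andP[i0 ->]].
    by rewrite -ltnNge andbT.
  by split => //; apply/negP; rewrite -ltnNge.
have cI n : counting (I n) = n%:R%:E :> \bar R.
  rewrite /counting asboolT; last exact/finite_setD/finite_II.
  by rewrite (card_fset_set (card_IID (n := n.+1) (k := 1))) subn1.
split=> [kA|kx]; last first.
  rewrite -cI; apply: le_measure; rewrite ?inE//.
  move=> i /IE/andP[i0 ik]; split => //.
  by rewrite (le_trans _ kx)// lee_fin arrival_le.
rewrite leNgt; apply/negP => xk.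
have : (counting A <= k.-1%:R%:E :> \bar R)%E.
  rewrite -cI; apply: le_measure; rewrite ?inE//.
  move=> i [i0 ix]; apply/IE; rewrite i0/= -ltnS prednK// ltnNge; apply/negP => ki.
  have : ((arrival W k w)%:E <= (arrival W i w)%:E)%E by rewrite lee_fin arrival_le.
  by move=> /(lt_le_trans xk); rewrite ltNge ix.
apply/negP; rewrite -ltNge; apply: lt_le_trans kA.
by rewrite lte_fin ltr_nat ltn_predL.
Qed.

Variable sigma : R -> T -> R.
Hypotheses (sigma_incr : forall s t, 0 <= s -> s < t -> sigma s w < sigma t w)
           (sigma0 : sigma 0 w = 0).

(** A number is below an infimum exactly when no element of the set precedes it. Only values of
    [sigma] strictly before [a] occur, which is why epochs turn out to be left limits. *)
Lemma inverse_process_ge t a :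
  (a%:E <= inverse_process sigma t w)%E <->
  forall u, 0 <= u -> u < a -> sigma u w <= t.
Proof.
split => [H u u0 ua|H].
  rewrite leNgt; apply/negP => tu.
  have : (inverse_process sigma t w <= u%:E)%E by apply: ereal_inf_lbound; exists u.
  by move=> /(le_trans H); rewrite lee_fin leNgt ua.
apply: le_ereal_inf_tmp => _ [u /= [u0 tu] <-]; rewrite lee_fin leNgt; apply/negP => ua.
by have := H u u0 ua; rewrite leNgt tu.
Qed.

(* The [k]-th epoch is the least [t >= 0] bounding [sigma] on [[0, a[], where [a]
   is the [k]-th arrival: the left limit of [sigma] at [a] if [k > 0]. *)
Lemma cvg_epoch (psi : R -> T -> \bar R) k :
  (forall t, 0 <= t -> psi t w = inverse_process sigma t w) ->
  sigma ((1 - m.+1%:R^-1) * arrival W k w) w @[m --> \oo] -->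
  epoch (fun t w => counting_process W (psi t w) w) k w.
Proof.
move=> psiE; set a := arrival W k w.
have a0 : 0 <= a by exact: arrival_ge0.
have sigma_le u v : 0 <= u -> u <= v -> sigma u w <= sigma v w.
  by move=> u0; rewrite le_eqVlt => /predU1P[->//|uv]; rewrite ltW// sigma_incr.
pose c m : R := 1 - m.+1%:R^-1.
have c0 m : 0 <= c m by rewrite subr_ge0 invf_le1// ler1n.
have c1 m : c m < 1 by rewrite ltrBlDr ltrDl.
have cle m n : (m <= n)%N -> c m <= c n.
  by move=> mn; rewrite lerD2l lerN2 lef_pV2 ?posrE// ler_nat.
pose u m := sigma (c m * a) w.
have und : {homo u : m n / (m <= n)%N >-> m <= n}.
  by move=> m n mn; apply: sigma_le; rewrite ?mulr_ge0// ler_wpM2r// cle.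
have ua m : u m <= sigma a w by apply: sigma_le; rewrite ?mulr_ge0// ler_piMl// ltW.
have hu : has_ubound (range u) by exists (sigma a w) => _ [m _ <-].
(* The sequence [u] is nondecreasing and bounded by [sigma a], so it tends to its supremum; what
   remains is to show that the epoch is this supremum. *)
rewrite (_ : epoch _ _ _ = sup (range u)); first exact: nondecreasing_cvgn.
rewrite /epoch (_ : [set t | _] =
    [set t | 0 <= t /\ forall u, 0 <= u -> u < a -> sigma u w <= t]); last first.
  apply/seteqP; split => t /= [t0 H]; split => //.
    (* For [k = 0] both conditions are vacuous: no [v >= 0] is below [a = 0], and every count is at
       least 0. *)
    case: (posnP k) => [k0 v v0|k0].
      by rewrite /a k0 /arrival big_ord0 ltNge v0.
    by apply/inverse_process_ge; rewrite -psiE//; exact/counting_process_ge.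
  case: (posnP k) => [->|k0]; first by rewrite /counting_process measure_ge0.
  by apply/counting_process_ge => //; rewrite psiE//; exact/inverse_process_ge.
set E := [set t | _].
have supE : E (sup (range u)).
  split => [|v v0 va].
    (* As [c 0 = 0], the first term [u 0] is [sigma 0 = 0]. *)
    apply: (le_trans _ (ub_le_sup hu (_ : range u (u 0%N)))); last by exists 0%N.
    by rewrite /u /c invr1 subrr mul0r sigma0.
  have [m vm] : exists m, v < c m * a.
    have : c m * a @[m --> \oo] --> a.
      rewrite -[X in _ --> X]mul1r; apply: cvgMl; rewrite -[X in _ --> X]subr0.
      by apply: cvgB; [exact: cvg_cst|exact: cvg_harmonic].
    by move=> /cvgr_gt /(_ v va) [m _ /(_ m (leqnn m))]; exists m.
  apply: (le_trans (sigma_le _ _ v0 (ltW vm))).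
  by apply: ub_le_sup => //; exists m.
apply/le_anti/andP; split.
  by apply: ge_inf => //; exists 0 => t [].
apply: lb_le_inf; first by exists (sup (range u)).
move=> t [t0 Ht]; apply: ge_sup; first by exists (u 0%N), 0%N.
move=> _ [m _ <-].
have ca : 0 <= c m * a by rewrite mulr_ge0.
(* If [a = 0] then [c m * a] is not strictly below [a], but [u m = sigma 0 = 0] is at most [t]
   anyway. *)
have [a00|a_gt0] : 0 = a \/ 0 < a by move: a0; rewrite le_eqVlt => /predU1P.
  by rewrite /u -a00 mulr0 sigma0.
by apply: Ht => //; rewrite gtr_pMl.
Qed.
End Epochs.

(** * Matrix identities and complex exponentials *)

Section Algebra.
Variable R : realType.

Lemma dotp_trmx n (A : 'M[R]_n) (u v : 'cV[R]_n) :
  dotp (A^T *m u) v = dotp u (A *m v).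
Proof.
rewrite /dotp; under eq_bigr do rewrite mxE big_distrl /=.
rewrite exchange_big /=; apply: eq_bigr => i _.
rewrite mxE big_distrr /=; apply: eq_bigr => j _.
by rewrite mxE mulrCA mulrA.
Qed.

(** [Kmx] shifts the entries down by one and leaves 0 in the first row, where [g 0 = 0] supplies the
    missing term. *)
Lemma Amx_mul n (g : nat -> R) : g 0%N = 0 ->
  Amx R n *m \col_(k < n) g k.+1 = \col_(k < n) (g k.+1 - g k).
Proof.
move=> g0; rewrite /Amx mulmxBl mul1mx; apply/matrixP => i j; rewrite !mxE.
congr (_ - _); case: i => -[|i] /= ilt.
  by rewrite big1// => k _; rewrite !mxE /= mul0r.
have il : (i < n)%N by exact: ltnW.
rewrite (bigD1 (Ordinal il))//= big1 ?addr0; first by rewrite !mxE /= eqxx mul1r.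
move=> k /negP ki; rewrite !mxE /= eqSS; case: eqP => [ik|_]; last by rewrite mul0r.
by exfalso; apply: ki; apply/eqP/val_inj.
Qed.

Lemma Bmx_mul n (v : 'cV[R]_n) (i : 'I_n) :
  (Bmx R n *m v) i 0 = \sum_(j < n | (j <= i)%N) v j 0.
Proof.
rewrite mxE [RHS]big_mkcond /=; apply: eq_bigr => j _.
by rewrite mxE; case: ifP; rewrite (mul1r, mul0r).
Qed.

Lemma cexp_imaginary (x : R) : cexp (Complex 0 x) = Complex (cos x) (sin x).
Proof. by rewrite /cexp /= expR0 !mul1r. Qed.

Lemma cexp_subr (z : R[i]) (x : R) :
  cexp (z - x%:C%C) = Complex (expR (- x) * complex.Re (cexp z))
                              (expR (- x) * complex.Im (cexp z)).
Proof.
case: z => a b; rewrite /cexp /= subr0.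
by rewrite expRD mulrC !mulrA [_ * expR a]mulrC; congr Complex; ring.
Qed.

Lemma charfunE d (T : measurableType d) (P : probability T R) n
    (X : T -> 'cV[R]_n) (xi : 'cV[R]_n) :
  charfun P X xi = Complex (\int[P]_w cos (dotp xi (X w)))
                           (\int[P]_w sin (dotp xi (X w))).
Proof.
rewrite /charfun /cintegral.
by congr Complex; apply: eq_Rintegral => w _; rewrite cexp_imaginary.
Qed.

Lemma real_mulC (a x y : R) : (a%:C)%C * Complex x y = Complex (a * x) (a * y).
Proof. by apply/eqP; rewrite eq_complex /= !mul0r subr0 addr0 !eqxx. Qed.

End Algebra.

(** * The process at contracted partial sums of a tuple *)

Section TimeChange.
Context d (T : measurableType d) (R : realType) (P : probability T R).
Variables (sigma : R -> {RV P >-> R}) (h : R -> R).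
Hypotheses (h_cont : continuous h) (h_le1 : forall x, `|h x| <= 1).

(* The truncation at [0] only matters for tuples with negative entries. *)
Definition path_fun n (eta : 'cV[R]_n) (c : R)
    (p : path_space sigma * n.-tuple R) : R :=
  h (dotp eta (\col_k sigma (Num.max (c * (Bmx R n *m col_of p.2) k 0) 0) p.1)).

Lemma measurable_path_fun n (eta : 'cV[R]_n) c : right_continuous_process sigma ->
  measurable_fun setT (path_fun eta c).
Proof.
move=> sigma_rc; apply: measurableT_comp; first exact: continuous_measurable_fun.
rewrite /dotp; apply: measurable_sum => k; apply: measurable_funM => //.
rewrite (_ : (fun p => _) =
    (fun q : R * path_space sigma => sigma (Num.max q.1 0) q.2) \o
    (fun p : path_space sigma * n.-tuple R =>
       (c * (Bmx R n *m col_of p.2) k 0, p.1))); last first.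
  by apply/funext => p /=; rewrite mxE.
apply: measurableT_comp; first exact: measurable_path_joint.
apply: measurable_fun_pair => //; apply: measurable_funM => //.
rewrite (_ : (fun p => _) = fun p : path_space sigma * n.-tuple R =>
    \sum_(j < n) Bmx R n k j * tnth p.2 j); last first.
  by apply/funext => p; rewrite mxE; apply: eq_bigr => j _; rewrite [col_of _ _ _]mxE.
apply: measurable_sum => j; apply: measurable_funM => //.
apply: (measurableT_comp (measurable_tnth j)); exact: measurable_snd.
Qed.

Definition contraction m : R := 1 - m.+1%:R^-1.

Lemma contraction_ge0 m : 0 <= contraction m.
Proof. by rewrite subr_ge0 invf_le1// ler1n. Qed.

Lemma cvg_contraction : contraction @ \oo --> (1 : R).
Proof.
rewrite -[X in _ --> X]subr0.
by apply: cvgB; [exact: cvg_cst|exact: cvg_harmonic].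
Qed.

Lemma cvg_dotp n (eta : 'cV[R]_n) (v : nat -> 'cV[R]_n) (l : 'cV[R]_n) :
  (forall k, v m k 0 @[m --> \oo] --> l k 0) ->
  h (dotp eta (v m)) @[m --> \oo] --> h (dotp eta l).
Proof.
move=> vl; apply: continuous_cvg; first exact: h_cont.
rewrite /dotp; apply: cvg_big => [|k _]; first exact: add_continuous.
by apply: cvgM; [exact: cvg_cst|exact: vl].
Qed.

(** For a fixed tuple only the [n] deterministic times [tau k] matter, and almost surely [sigma] is
    continuous at all of them. *)
Lemma cvg_path_fun n (eta : 'cV[R]_n) (t : n.-tuple R) :
  no_fixed_discontinuity P sigma ->
  {ae P, forall w, path_fun eta (contraction m) (w, t) @[m --> \oo] -->
                   path_fun eta 1 (w, t)}.
Proof.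
move=> sigma_nofix; pose tau (k : 'I_n) := (Bmx R n *m col_of t) k 0.
have : {ae P, forall w, forall k : 'I_n,
    sigma s w @[s --> within [set s : R | 0 <= s] (nbhs (Num.max (tau k) 0))] -->
    sigma (Num.max (tau k) 0) w}.
  apply: filter_forall => k; apply: sigma_nofix.
  by rewrite le_max lexx orbT.
apply: filterS => w H; apply: cvg_dotp => k; rewrite [X in _ --> X]mxE /= mul1r.
under eq_fun do rewrite mxE/=.
rewrite -/(tau k).
apply: (@cvg_comp _ _ _ (fun m => Num.max (contraction m * tau k) 0)
  (fun s => sigma s w) _ _ _ _ (H k)).
have : Num.max (contraction m * tau k) 0 @[m --> \oo] --> Num.max (tau k) 0.
  rewrite (_ : (fun m => _) = fun m => contraction m * Num.max (tau k) 0).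
    rewrite -[X in _ --> X]mul1r; apply: cvgMl; exact: cvg_contraction.
  by apply/funext => m; rewrite maxr_pMr ?contraction_ge0// mulr0.
move=> cm A wA.
pose u m := Num.max (contraction m * tau k) 0.
(* Continuity is relative to nonnegative times; the truncation at 0 keeps every [u m] among them. *)
have uA : \forall m \near \oo, 0 <= u m -> A (u m) by exact: (cm _ wA).
suff : \forall m \near \oo, A (u m) by [].
by apply: filterS uA => m; apply; rewrite /u le_max lexx orbT.
Qed.
End TimeChange.
Arguments path_fun {d T R P} sigma h {n} eta c p.

(** * Exponential waiting times *)

Section WaitingTimes.
Context d (T : measurableType d) (R : realType) (P : probability T R).
Context (lambda : R) (lambda_gt0 : 0 < lambda).
Variable W : nat -> {RV P >-> R}.
Hypothesis W_indep : mutually_independent P W.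
Hypothesis W_exp : forall k (A : set R), measurable A ->
  distribution P (W k) A = exponential_prob lambda A.

HB.instance Definition _ n := isMeasurableFun.Build _ _ _ _
  (initial_tuple W n) (@measurable_initial_tuple _ _ _ _ W n).

(** The density vanishes on negative numbers but not at 0, so the Lebesgue-null point 0 is removed
    first. *)
Lemma exponential_pos k : P (W k @^-1` `]-oo, 0]) = 0%E.
Proof.
have -> : P (W k @^-1` `]-oo, 0]) = distribution P (W k) `]-oo, 0] by [].
rewrite W_exp// /exponential_prob.
have mf : measurable_fun setT (fun x => (exponential_pdf lambda x)%:E).
  by apply/measurable_EFinP; exact: measurable_exponential_pdf.
rewrite (@ge0_negligible_integral _ _ _ _ _
  ([set 0] : set (measurableTypeR R)))//; last 3 first.
- exact: measurable_funTS.
- by move=> x _; rewrite lee_fin exponential_pdf_ge0// ltW.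
- exact: lebesgue_measure_set1.
rewrite integral0_eq// => x [/=]; rewrite in_itv /= => x0 /eqP xn0.
by rewrite lt0_exponential_pdf// lt_neqAle xn0.
Qed.

Lemma waiting_gt0 : {ae P, forall w, forall k, 0 < W k w}.
Proof.
exists (\bigcup_k (W k @^-1` `]-oo, 0])); split.
- by apply: bigcup_measurable => k _; exact: measurable_funPTI.
- apply/negligibleP; first by apply: bigcup_measurable => k _; exact: measurable_funPTI.
  apply: negligible_bigcup => k; apply/negligibleP; first exact: measurable_funPTI.
  exact: exponential_pos.
- move=> w /existsNP[k /negP]; rewrite -leNgt => Wk.
  by exists k => //=; rewrite in_itv /=.
Qed.

Lemma Rintegral_initial_tuple n (f : n.-tuple R -> R) : measurable_fun setT f ->
  \int[distribution P (initial_tuple W n)]_t f t =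
  \int[lebesgue_tuple R n]_t (f t * tuple_pdf (exponential_pdf lambda) t).
Proof.
move=> mf; pose nu : {sigma_finite_measure set (measurableTypeR R) -> \bar R} :=
  exponential_distribution_exponential_prob__canonical__measure_function_SigmaFiniteMeasure
    lambda_gt0.
rewrite lebesgue_tupleE -(@Rintegral_tuple_density _ _ nu)//; last 2 first.
- exact: measurable_exponential_pdf.
- by move=> x; rewrite exponential_pdf_ge0// ltW.
rewrite /Rintegral; congr fine; apply: eq_measure_integral => A mA _.
exact: (@initial_tuple_law _ _ _ _ W nu W_indep W_exp n A mA).
Qed.

End WaitingTimes.

(** Brings events about the tuple under the independence hypothesis: a tuple is measurable for a
    sigma-algebra as soon as its coordinates are. *)
Lemma sigma_of_initial_tuple d (T : measurableType d) (R : realType)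
    (P : probability T R) (W : nat -> {RV P >-> R}) n (B : set (n.-tuple R)) :
  measurable B -> sigma_of setT W (initial_tuple W n @^-1` B).
Proof.
pose G := \bigcup_(i in [set: nat]) preimage_set_system setT (W i) measurable.
have mt : measurable_fun [set: g_sigma_algebraType G]
    (initial_tuple W n : g_sigma_algebraType G -> _).
  apply/measurable_fun_tnthP => i _ A mA; rewrite setTI.
  apply: sub_sigma_algebra; exists (i : nat) => //; exists A => //.
  rewrite setTI; apply/seteqP; split => w /=; by rewrite tnth_mktuple.
by move=> mB; have := mt measurableT B mB; rewrite setTI.
Qed.

(** * Expectation of a function of the waiting times of [Y] *)

Section MainIntegral.
Context d (T : measurableType d) (R : realType) (P : probability T R).
Context (lambda : R) (lambda_gt0 : 0 < lambda).
Variable W : nat -> {RV P >-> R}.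
Hypothesis W_indep : mutually_independent P W.
Hypothesis W_exp : forall k (A : set R), measurable A ->
  distribution P (W k) A = exponential_prob lambda A.
Variable sigma : R -> {RV P >-> R}.
Hypothesis sigma_rc : right_continuous_process sigma.
Hypothesis sigma_incr : strictly_increasing_process P sigma.
Hypothesis sigmaW_indep : independent_sigma P
  (sigma_of [set t : R | 0 <= t] sigma) (sigma_of setT W).
Hypothesis sigma_nofix : no_fixed_discontinuity P sigma.
Hypothesis sigma_0 : {ae P, forall w, sigma 0 w = 0}.
Variable psi : R -> T -> \bar R.
Hypothesis psi_def : forall (t : R) (w : T), 0 <= t ->
  psi t w = inverse_process sigma t w.
Variable J : nat -> T -> R.
Hypothesis J_def : forall k w,
  J k w = inter_arrival (fun t w => counting_process W (psi t w) w) k w.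
Variable n : nat.
Variable h : R -> R.
Hypotheses (h_cont : continuous h) (h_le1 : forall x, `|h x| <= 1).
Variable xi : 'cV[R]_n.

Let eta : 'cV[R]_n := (Amx R n)^T *m xi.

(** [Bmx] turns waiting times into arrivals, and the transpose in [eta], moved to the other side of
    the product, turns values of [sigma] into increments. *)
Lemma path_fun_initial_tuple c w : (forall k, 0 < W k w) -> sigma 0 w = 0 -> 0 <= c ->
  path_fun sigma h eta c (w, initial_tuple W n w) =
  h (dotp xi (\col_(k < n)
    (sigma (c * arrival W k.+1 w) w - sigma (c * arrival W k w) w))).
Proof.
move=> W0 s0 c0; rewrite /path_fun /eta dotp_trmx; congr (h (dotp _ _)).
rewrite -(@Amx_mul _ n (fun k => sigma (c * arrival W k w) w)); last first.
  by rewrite /arrival big_ord0 mulr0.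
congr (_ *m _); apply/matrixP => k j; rewrite [LHS]mxE [RHS]mxE /=.
have -> : (Bmx R n *m col_of (initial_tuple W n w)) k 0 = arrival W k.+1 w.
  rewrite Bmx_mul /arrival (big_ord_widen_cond n xpredT (fun j => W j w))//=.
  by apply: eq_big => i //= _; rewrite mxE tnth_mktuple.
rewrite (max_idPl _)// mulr_ge0//; exact: arrival_ge0.
Qed.

Lemma cvg_path_fun_J : {ae P, forall w,
  path_fun sigma h eta (contraction R m) (w, initial_tuple W n w) @[m --> \oo] -->
  h (dotp xi (\col_(k < n) J k w))}.
Proof.
have W0 := waiting_gt0 lambda_gt0 W_exp.
apply: filterS3 W0 sigma_incr sigma_0 => w Ww sw s0.
under eq_fun do rewrite path_fun_initial_tuple ?contraction_ge0//.
apply: cvg_dotp => // k; rewrite [X in _ --> X]mxE J_def /inter_arrival.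
under eq_fun do rewrite mxE.
have psiw t : 0 <= t -> psi t w = inverse_process sigma t w by exact: psi_def.
by apply: cvgB; apply: (@cvg_epoch _ _ _ W w Ww sigma sw s0 psi _ psiw).
Qed.

Let Phi (t : n.-tuple R) : R := \int[P]_w path_fun sigma h eta 1 (w, t).

(** One sequence of expectations has two limits. With the random tuple inserted, [cvg_path_fun_J]
    gives the left side; after separating path and tuple by independence, [cvg_path_fun] gives the
    integral of [Phi]. *)
Lemma Rintegral_waiting_times :
  \int[P]_w h (dotp xi (\col_(k < n) J k w)) =
  \int[lebesgue_tuple R n]_t (Phi t * tuple_pdf (exponential_pdf lambda) t).
Proof.
pose X : {mfun T >-> path_space sigma} := to_path_space sigma.
pose Y : {mfun T >-> n.-tuple R} := initial_tuple W n.
have mF c : measurable_fun setT (path_fun sigma h eta c).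
  exact: measurable_path_fun.
have F1 c p : `|path_fun sigma h eta c p| <= 1 by exact: h_le1.
have mPhi c : measurable_fun setT (fun t => \int[P]_w path_fun sigma h eta c (w, t)).
  exact: (@measurable_Rintegral_fst _ _ _ _ _ _ _ P X Y _ 1).
rewrite -(Rintegral_initial_tuple lambda_gt0 W_indep W_exp (mPhi 1)).
have [N [mN N0 cN]] := cvg_path_fun_J.
have cvgJ :
    \int[P]_w path_fun sigma h eta (contraction R m) (w, initial_tuple W n w)
    @[m --> \oo] --> \int[P]_w h (dotp xi (\col_(k < n) J k w)).
  apply: (@cvg_Rintegral_bounded _ _ _ P N _ _ 1 mN N0) => [m|m w|w Nw].
  - apply: (measurableT_comp (mF (contraction R m))).
    apply: measurable_fun_pair; first exact: measurable_to_path_space.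
    exact: measurable_initial_tuple.
  - exact: F1.
  - by apply: contrapT => /cN.
have mFt c t : measurable_fun setT (fun w : T => path_fun sigma h eta c (w, t)).
  apply: (measurableT_comp (mF c)).
  by apply: measurable_fun_pair => //; exact: measurable_to_path_space.
have cvgPhi : \int[distribution P Y]_t
      \int[P]_w path_fun sigma h eta (contraction R m) (w, t)
    @[m --> \oo] --> \int[distribution P Y]_t Phi t.
  (* The null set [Nt] below depends on [t], but the inner integrals converge for every [t], so the
     outer exceptional set is empty. *)
  apply: (@cvg_Rintegral_bounded _ _ _ _ set0 _ _ 1) => // [m t|t _].
    by apply: normr_Rintegral_le => // w; exact: F1.
  have [Nt [mNt Nt0 cNt]] := cvg_path_fun h_cont eta t sigma_nofix.
  apply: (@cvg_Rintegral_bounded _ _ _ P Nt _ _ 1) => // w Nw.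
  by apply: contrapT => /cNt.
have indep A B : measurable A -> measurable B ->
    P (X @^-1` A `&` Y @^-1` B) = (P (X @^-1` A) * P (Y @^-1` B))%E.
  by move=> mA mB; apply: sigmaW_indep => //; exact: sigma_of_initial_tuple.
have indepE m := Rintegral_independent indep (mF (contraction R m)) (F1 _).
move: cvgJ; rewrite (funext indepE) => cvgJ.
exact: (cvg_unique _ cvgJ cvgPhi).
Qed.
End MainIntegral.

(** * The product exponential density *)

Section ExponentialDensity.
Context (R : realType) (lambda : R) (lambda_gt0 : 0 < lambda).

Lemma tuple_pdf_exponential n (t : n.-tuple R) : (forall j, 0 <= tnth t j) ->
  tuple_pdf (exponential_pdf lambda) t =
  lambda ^+ n * expR (- (lambda * \sum_(j < n) tnth t j)).
Proof.
move=> t0; rewrite /tuple_pdf.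
under eq_bigr do rewrite exponential_pdfE//.
rewrite big_split /= prodr_const card_ord; congr (_ * _).
by rewrite -expR_sum mulr_sumr -sumrN; congr expR; apply: eq_bigr => j _; rewrite mulNr.
Qed.

Lemma tuple_pdf_exponential_out n (t : n.-tuple R) : ~ (forall j, 0 <= tnth t j) ->
  tuple_pdf (exponential_pdf lambda) t = 0.
Proof.
move=> /existsNP[j /negP]; rewrite -ltNge => tj.
by rewrite /tuple_pdf (bigD1 j)//= lt0_exponential_pdf// mul0r.
Qed.

(** The integral is the total mass of a product of [n] exponential laws, by the density formula
    applied to the constant 1. *)
Lemma integrable_tuple_pdf n : (lebesgue_tuple R n).-integrable setT
  (fun t => (tuple_pdf (exponential_pdf lambda) t)%:E).
Proof.
have p0 x : 0 <= exponential_pdf lambda x by rewrite exponential_pdf_ge0// ltW.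
have mp := measurable_exponential_pdf lambda.
pose nu : {sigma_finite_measure set (measurableTypeR R) -> \bar R} :=
  exponential_distribution_exponential_prob__canonical__measure_function_SigmaFiniteMeasure
    lambda_gt0.
apply/integrableP; split; first by apply/measurable_EFinP; exact: measurable_tuple_pdf.
under eq_integral do rewrite gee0_abs ?lee_fin ?tuple_pdf_ge0//.
have := @ge0_integral_tuple_density _ lebesgue_measure nu _ mp p0 _ n (cst 1%E).
rewrite lebesgue_tupleE.
under [X in (_ = X)%E]eq_integral do rewrite mul1e.
move=> <- //; rewrite integral_cst// mul1e.
rewrite (_ : [set: _] =
    [set t : n.-tuple R | forall i : 'I_n, setT (tnth t i)]); last first.
  by apply/seteqP; split.
rewrite (tuple_measure_rectangle nu (A := fun=> setT))// big1 ?ltry// => i _.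
exact: integral_exponential_pdf.
Qed.

End ExponentialDensity.

(** Each coordinate hyperplane is a rectangle with a null side. If some waiting time is 0, the times
    [Bmx R n *m col_of t] are not strictly increasing and [Gamma] is unconstrained there; such
    tuples can thus be ignored. *)
Lemma lebesgue_tuple_neq0 (R : realType) n :
  {ae lebesgue_tuple R n, forall t, forall j, tnth t j <> 0}.
Proof.
apply: filter_forall => j.
pose A i : set R := if i == j then [set 0] else setT.
have mA i : measurable (A i) by rewrite /A; case: ifP.
exists [set t : n.-tuple R | forall i, A i (tnth t i)]; split.
- exact: measurable_rectangle.
- rewrite lebesgue_tupleE tuple_measure_rectangle// (bigD1 j)//= /A eqxx.
  by rewrite lebesgue_measure_set1 mul0e.
- move=> t /contrapT tj i; rewrite /A; case: ifP => // /eqP ->; exact: tj.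
Qed.

Lemma increasing_times_Bmx (R : realType) n (t : n.-tuple R) :
  (forall j, 0 < tnth t j) -> increasing_times (Bmx R n *m col_of t).
Proof.
move=> t0; split=> [i|i j ij]; rewrite !Bmx_mul.
  by apply: sumr_ge0 => k _; rewrite mxE ltW.
rewrite [ltRHS](bigID (fun k : 'I_n => (k <= i)%N))/=.
rewrite [X in _ < X + _](eq_bigl (fun k : 'I_n => (k <= i)%N)); last first.
  by move=> k; case: (leqP k i) => ki; rewrite ?andbF// andbT (leq_trans ki)// ltnW.
rewrite ltrDl (bigD1 j) ?leqnn ?andTb -?ltnNge//=.
rewrite ltr_pwDl ?mxE// sumr_ge0// => k _; rewrite mxE ltW//.
Qed.

(** * From the density to the integral over nonnegative tuples *)

Section RightHandSide.
Context d (T : measurableType d) (R : realType) (P : probability T R).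
Context (lambda : R) (lambda_gt0 : 0 < lambda).
Variable sigma : R -> {RV P >-> R}.

Lemma path_fun1 h n (eta : 'cV[R]_n) (t : n.-tuple R) w : (forall j, 0 < tnth t j) ->
  path_fun sigma h eta 1 (w, t) =
  h (dotp eta (at_times sigma (Bmx R n *m col_of t) w)).
Proof.
move=> t0; rewrite /path_fun; congr (h (dotp _ _)).
apply/matrixP => k j; rewrite [LHS]mxE [RHS]mxE mul1r (max_idPl _)//.
by have [+ _] := increasing_times_Bmx t0; exact.
Qed.

Hypothesis sigma_rc : right_continuous_process sigma.

(** The integrand [g] is prescribed on positive tuples only. Among nonnegative tuples the others
    form a null set, and outside the orthant the density is 0. *)
Lemma Rintegral_exponential_density h n (eta : 'cV[R]_n) (g : n.-tuple R -> R) :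
  continuous h -> (forall x, `|h x| <= 1) ->
  (forall t : n.-tuple R, (forall j, 0 < tnth t j) ->
     g t = expR (- (lambda * \sum_(j < n) tnth t j)) *
           \int[P]_w path_fun sigma h eta 1 (w, t)) ->
  \int[lebesgue_tuple R n]_t (\int[P]_w path_fun sigma h eta 1 (w, t) *
    tuple_pdf (exponential_pdf lambda) t) =
  lambda ^+ n *
  \int[lebesgue_tuple R n]_(t in [set t | forall j, 0 <= tnth t j]) g t.
Proof.
move=> h_cont h_le1 gE.
pose Phi (t : n.-tuple R) := \int[P]_w path_fun sigma h eta 1 (w, t).
pose p := @tuple_pdf _ (exponential_pdf lambda) n.
have mF : measurable_fun setT (path_fun sigma h eta 1) by exact: measurable_path_fun.
have mPhi : measurable_fun setT Phi.
  have mcst : measurable_fun setT (cst point : T -> n.-tuple R) by [].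
  pose Y : {mfun T >-> n.-tuple R} := cst point.
  apply: (@measurable_Rintegral_fst _ _ _ _ _ _ _ P (to_path_space sigma) Y _ 1) => // q.
  exact: h_le1.
have Phi1 t : `|Phi t| <= 1.
  apply: normr_Rintegral_le => [|w]; last exact: h_le1.
  apply: (measurableT_comp mF).
  by apply: measurable_fun_pair => //; exact: measurable_to_path_space.
have iPhip : (lebesgue_tuple R n).-integrable setT (fun t => (Phi t * p t)%:E).
  apply: (le_integrable _ _ _ (integrable_tuple_pdf lambda_gt0 n)) => //.
    apply/measurable_EFinP; apply: measurable_funM => //.
    by apply: measurable_tuple_pdf; exact: measurable_exponential_pdf.
  by move=> t _; rewrite /= lee_fin normrM ler_piMl.
have [N [mN N0 nN]] := lebesgue_tuple_neq0 R n.
have ln0 : lambda ^+ n != 0 by rewrite expf_neq0// gt_eqF.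
(* The inverse power of [lambda] cancels the normalizing constant of the density, which [g] does not
   contain. *)
rewrite [X in _ = _ * X](@Rintegral_null_eq _ _ _ _ N _ g
    (fun t => (lambda ^+ n)^-1 * (Phi t * p t)))//; last first.
  move=> t /= t0 Nt; have tn0 j : 0 < tnth t j.
    rewrite lt_neqAle t0 andbT eq_sym; apply/eqP.
    have : forall j, tnth t j <> 0 by apply: contrapT => /nN.
    exact.
  by rewrite gE// /p tuple_pdf_exponential// -/(Phi t); field.
rewrite [X in _ = _ * X]Rintegral_mkcond [X in _ = _ * X](_ : _ =
    \int[lebesgue_tuple R n]_t ((lambda ^+ n)^-1 * (Phi t * p t))); last first.
  apply: eq_Rintegral => t _.
  rewrite /patch; case: ifPn => //.
  by rewrite notin_setE /= => nt; rewrite /p tuple_pdf_exponential_out// !mulr0.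
by rewrite RintegralZl// mulrA divff// mul1r.
Qed.

End RightHandSide.

Theorem corollary3p2
  (R : realType) (d : measure_display) (T : measurableType d)
  (P : probability T R)
  (lambda alpha : R) (lambda_gt0 : 0 < lambda)
  (alpha_gt0 : 0 < alpha) (alpha_lt1 : alpha < 1)
  (d' : measure_display) (E : measurableType d')
  (Mt : nat -> {RV P >-> E}) (Mt_markov : markov_chain P Mt)
  (W : nat -> {RV P >-> R})
  (W_indep : mutually_independent P W)
  (W_exp : forall k (A : set R), measurable A ->
     distribution P (W k) A = exponential_prob lambda A)
  (MtW_indep : independent_sigma P (sigma_of setT Mt) (sigma_of setT W))
  (M : R -> T -> E)
  (M_def : forall (t : R) (w : T) (k : nat), 0 <= t ->
     counting_process W t%:E w = k%:R%:E -> M t w = Mt k w)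
  (sigma : R -> {RV P >-> R})
  (sigma_rc : right_continuous_process sigma)
  (sigma_incr : strictly_increasing_process P sigma)
  (sigma_stable : stable_process P alpha sigma)
  (Gamma : forall k, 'cV[R]_k -> {finite_measure set (k.-tuple R) -> \bar R})
  (Gamma_spectral : forall k (t : 'cV[R]_k), (0 < k)%N -> increasing_times t ->
     spectral_measure P alpha (at_times sigma t) (Gamma k t))
  (sigma_indep : independent_sigma P (sigma_of [set t : R | 0 <= t] sigma)
     <<s sigma_of setT Mt `|` sigma_of setT W >>)
  (sigma_nofix : no_fixed_discontinuity P sigma)
  (sigma_0 : {ae P, forall w, sigma 0 w = 0})
  (psi : R -> T -> \bar R)
  (psi_def : forall (t : R) (w : T), 0 <= t ->
     psi t w = inverse_process sigma t w)
  (Y : R -> T -> E)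
  (Y_def : forall (t s : R) (w : T), 0 <= t -> psi t w = s%:E -> Y t w = M s w)
  (J : nat -> T -> R)
  (J_def : forall k w,
     J k w = inter_arrival (fun t w => counting_process W (psi t w) w) k w)
  (n : nat) (n_gt0 : (0 < n)%N) (xi : 'cV[R]_n) :
  charfun P (fun w => \col_(k < n) J k w) xi =
  (lambda ^+ n)%:C%C *
  cintegral (@lebesgue_tuple R n)
    [set w : n.-tuple R | forall j, 0 <= tnth w j]
    (fun w => cexp
       (- cintegral (Gamma n (Bmx R n *m col_of w)) (Omega n)
            (fun s => cpow (Complex 0 (- dotp ((Amx R n)^T *m xi) (col_of s)))
                           alpha)
        - (lambda * \sum_(j < n) tnth w j)%:C%C)).
Proof.
have sigmaW_indep : independent_sigma P
    (sigma_of [set t : R | 0 <= t] sigma) (sigma_of setT W).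
  move=> A B sA sB; apply: sigma_indep => //.
  by apply: sub_sigma_algebra; right.
pose eta : 'cV[R]_n := (Amx R n)^T *m xi.
pose Psi (t : n.-tuple R) := cintegral (Gamma n (Bmx R n *m col_of t)) (Omega n)
  (fun s => cpow (Complex 0 (- dotp eta (col_of s))) alpha).
(* The spectral representation at the times [Bmx R n *m col_of t], evaluated at [eta]. *)
have charPsi (t : n.-tuple R) : (forall j, 0 < tnth t j) ->
    charfun P (at_times sigma (Bmx R n *m col_of t)) eta = cexp (- Psi t).
  move=> t0; have [_ ->//] := Gamma_spectral n _ n_gt0 (increasing_times_Bmx t0).
(* To be applied with [h] the cosine and the sine, and [g] the real and the imaginary part of the
   integrand on the right. *)
have key h (g : n.-tuple R -> R) : continuous h -> (forall x, `|h x| <= 1) ->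
    (forall t : n.-tuple R, (forall j, 0 < tnth t j) ->
     g t = expR (- (lambda * \sum_(j < n) tnth t j)) *
           \int[P]_w h (dotp eta (at_times sigma (Bmx R n *m col_of t) w))) ->
    \int[P]_w h (dotp xi (\col_(k < n) J k w)) = lambda ^+ n *
  \int[lebesgue_tuple R n]_(t in [set t | forall j, 0 <= tnth t j]) g t.
  move=> h_cont h_le1 gE.
  rewrite (Rintegral_waiting_times lambda_gt0 W_indep W_exp sigma_rc sigma_incr
    sigmaW_indep sigma_nofix sigma_0 psi_def J_def h_cont h_le1 xi).
  apply: Rintegral_exponential_density => // t t0; rewrite gE//; congr (_ * _).
  by apply: eq_Rintegral => w _; rewrite path_fun1.
rewrite charfunE /cintegral real_mulC; congr Complex; apply: key.
- exact: continuous_cos.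
- by move=> x; rewrite ler_norml cos_geN1 cos_le1.
- by move=> t t0; rewrite cexp_subr -(congr1 (@complex.Re R) (charPsi t t0)) charfunE.
- exact: continuous_sin.
- by move=> x; rewrite ler_norml sin_geN1 sin_le1.
- by move=> t t0; rewrite cexp_subr -(congr1 (@complex.Im R) (charPsi t t0)) charfunE.
Qed.
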